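(* Let $T$ be the $k$-regular tree and $P$ the infinite path. For any $\varphi:V(T)\to\mathbb C$, the spherical mean $M_\varphi$ satisfies $$(\Delta_T M_\varphi)(x,r)=\big((\Delta_P+(2-k)\partial_r)M_\varphi\big)(x,r)\quad\text{for all }x\in V(T),\ r\in\mathbb Z_+,$$ where $\Delta_T$ acts in the variable $x$ and $\Delta_P$, $\partial_r$ act in the variable $r$.
   Context: $T$ is the infinite $k$-regular tree with graph distance $d$; $S(r)=|\{z:d(z,x)=r\}|$ ($=1$ for $r=0$, $k(k-1)^{r-1}$ for $r>0$). The spherical mean is $M_\varphi(x,r)=\frac{1}{S(r)}\sum_{d(z,x)=r}\varphi(z)$ for $r\ge 0$, extended evenly: $M_\varphi(x,-r)=M_\varphi(x,r)$. $P$ is the path with vertex set $\mathbb Z$ and edges $\{r,r+1\}$. For a graph, $\Delta f(x)=m(x)f(x)-\sum_{y\sim x}f(y)$ with $m(x)$ the degree; thus $\Delta_T F(x)=kF(x)-\sum_{y\sim x}F(y)$ and $\Delta_P v(r)=2v(r)-v(r+1)-v(r-1)$. $\partial_r v(r)=v(r+1)-v(r)$ for $r\in\mathbb Z$. *)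

(* Defs.v *)
From mathcomp Require Import all_boot all_order all_algebra finmap.
From mathcomp Require Import boolp classical_sets functions cardinality fsbigop reals.
From mathcomp Require Import complex.

Set Implicit Arguments.
Unset Strict Implicit.
Unset Printing Implicit Defensive.

Import Order.TTheory GRing.Theory Num.Theory.

Local Open Scope classical_set_scope.
Local Open Scope ring_scope.

Section Graph.
Variables (V : choiceType) (E : rel V).

Definition neighbors (x : V) : set V := [set y | E x y].

(* [fset_set A] is empty when [A] is infinite: [degree] and [laplacian] are
   only meaningful on locally finite graphs. *)
Definition degree (x : V) : nat := #|` fset_set (neighbors x)|.

Definition laplacian (K : fieldType) (f : V -> K) (x : V) : K :=
  (degree x)%:R * f x - \sum_(y \in neighbors x) f y.

Definition walk (x y : V) (n : nat) : Prop :=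
  exists p : seq V, [/\ path E x p, last x p = y & size p = n].

Definition connected_graph : Prop := forall x y, exists n, walk x y n.

(* [ucycle] also accepts sequences of length at most 2, such as [:: x; y] for
   an edge xy; the cycles of a simple graph are those of length at least 3. *)
Definition acyclic_graph : Prop := forall c : seq V, ucycle E c -> (size c <= 2)%N.

Definition infinite_regular_tree (k : nat) : Prop :=
  [/\ symmetric E, irreflexive E, connected_graph & acyclic_graph] /\
  (forall x, (neighbors x #= `I_k)%card) /\ infinite_set [set: V].

(* The value is 0 when there is no walk from x to y. *)
Definition graph_dist (x y : V) : nat :=
  match pselect (exists n, `[< walk x y n >]) with
  | left exw => ex_minn exw
  | right _ => 0%N
  end.

Definition sphere (x : V) (n : nat) : set V := [set z | graph_dist z x = n].

Definition sphere_card (x : V) (n : nat) : nat := #|` fset_set (sphere x n)|.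

Definition spherical_mean (K : fieldType) (phi : V -> K) (x : V) (r : int) : K :=
  (sphere_card x `|r|%N)%:R^-1 * \sum_(z \in sphere x `|r|%N) phi z.

End Graph.

Definition path_edge : rel int := [rel r s | (s == r + 1) || (r == s + 1)].

Definition forward_diff (K : fieldType) (v : int -> K) (r : int) : K :=
  v (r + 1) - v r.

(* Main.v *)
(** Fix [z].  In a tree a vertex [x] has at most one neighbor that is not
    strictly farther from [z] than [x] itself: two such neighbors would be
    joined through [z] by a path avoiding [x], which closes up to a cycle.  So
    if [d(z,x) = n > 0], one neighbor of [x] lies at distance [n - 1] from [z]
    and the other [k - 1] at distance [n + 1].  Summing over the neighbors [y]
    of [x] the sum of [phi] over the sphere of radius [r] about [y] therefore
    gives the sphere sum of radius [r + 1] about [x] plus [k - 1] times ([k]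
    times if [r = 1]) the one of radius [r - 1].  For [phi = 1] this yields the
    cardinality of spheres, and dividing by it the claimed identity. *)

Require Import Defs.
From mathcomp Require Import all_boot all_order all_algebra finmap.
From mathcomp Require Import boolp classical_sets cardinality fsbigop reals.
From mathcomp Require Import complex.
From mathcomp Require Import zify ring.

Import Order.TTheory GRing.Theory Num.Theory.

Local Open Scope ring_scope.

(** * Distance in a connected undirected graph *)

Section GraphDist.
Context {V : choiceType} {E : rel V}.
Hypotheses (symE : symmetric E) (connE : connected_graph E).

Local Notation d := (graph_dist E).

Lemma walk_graph_dist x y : walk E x y (d x y).
Proof.
rewrite /graph_dist; case: pselect => [exw|nex].
  by case: ex_minnP => n /asboolP.
by case: nex; have [n w] := connE x y; exists n; apply/asboolP.
Qed.

Lemma graph_dist_le x y n : walk E x y n -> (d x y <= n)%N.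
Proof.
move=> w; rewrite /graph_dist; case: pselect => [exw|//].
by case: ex_minnP => m _; apply; apply/asboolP.
Qed.

Lemma walk_sym x y n : walk E x y n -> walk E y x n.
Proof.
case=> p [pp <- <-]; exists (rev (belast x p)); split.
- rewrite rev_path; apply: sub_path pp => u v /=; by rewrite symE.
- by case: p {pp} => //= a p; rewrite rev_cons last_rcons.
- by rewrite size_rev size_belast.
Qed.

Lemma graph_distC x y : d x y = d y x.
Proof.
by apply/eqP; rewrite eqn_leq; apply/andP; split;
  apply: graph_dist_le; apply: walk_sym; apply: walk_graph_dist.
Qed.

Lemma graph_dist_eq0 x y : (d x y == 0%N) = (x == y).
Proof.
apply/eqP/eqP => [d0|->].
  have := walk_graph_dist x y; rewrite d0 => -[p [_ <- /size0nil ->]] //.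
by apply/eqP; rewrite -leqn0; apply: graph_dist_le; exists [::].
Qed.

Lemma graph_dist_edge x y z : E x y -> (d z x <= (d z y).+1)%N.
Proof.
move=> xy; rewrite !(graph_distC z); have [p [pp lp sp]] := walk_graph_dist y z.
by apply: graph_dist_le; exists (y :: p); rewrite /= xy pp lp sp.
Qed.

Lemma graph_dist_pred {x z n} : d z x = n.+1 -> exists2 y, E x y & d z y = n.
Proof.
rewrite graph_distC => dn; have := walk_graph_dist x z.
rewrite dn => -[[|y p] [//= /andP[xy pp] lp [sp]]]; exists y => //.
have := graph_dist_edge x y z xy; rewrite (graph_distC z x) dn ltnS => le1.
apply/eqP; rewrite eqn_leq le1 andbT graph_distC; apply: graph_dist_le.
by exists p.
Qed.

(** Follow a geodesic from [y] to [z]. The bound shows that its vertices after [y] avoid every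
    vertex at least as far from [z] as [y]. *)
Lemma descending_path y z : exists p, [/\ path E y p, last y p = z &
  forall v, v \in p -> (d z v < d z y)%N].
Proof.
move: {2}(d z y) (erefl (d z y)) => n; elim: n y => [|n IH] y dy.
  by exists [::]; split => //=; apply/esym/eqP; rewrite -graph_dist_eq0 dy.
have [w yw dw] := graph_dist_pred dy; have [p [pp lp dp]] := IH w dw.
exists (w :: p); split => //=; first by rewrite yw.
move=> v; rewrite inE => /orP[/eqP->|/dp]; first by rewrite dw dy.
by rewrite dw dy => /ltnW.
Qed.

End GraphDist.

(** * Geodesics, finiteness and valency in the tree *)

Section Tree.
Context {V : choiceType} {E : rel V} {k : nat}.
Hypothesis treeE : infinite_regular_tree E k.

Local Notation d := (graph_dist E).

Let symE : symmetric E. Proof. by case: treeE => -[]. Qed.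
Let irrE x : E x x = false. Proof. by case: treeE => -[_ + _ _ _]; apply. Qed.
Let connE : connected_graph E. Proof. by case: treeE => -[]. Qed.
Let acycE : acyclic_graph E. Proof. by case: treeE => -[]. Qed.
Let cardN x : (neighbors E x #= `I_k)%card. Proof. by case: treeE => _ []. Qed.

(** Once the path is shortened to a simple one, prepending [a] closes it into a cycle, of length at
    least 3 if [b] and [c] differ. *)
Lemma acyclic_neighbor_uniq a b c p : E a b -> E a c ->
  path E b p -> last b p = c -> a \notin b :: p -> b = c.
Proof.
move=> ab ac pp lp; case/shortenP: pp lp => q pq uq sq lq ap.
apply/eqP; apply: contraT => bc.
have aq : a \notin b :: q.
  apply: contra ap; rewrite !inE => /orP[->//|/sq ->]; exact: orbT.
have /acycE : ucycle E (a :: b :: q).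
  rewrite /ucycle /= rcons_path ab pq lq symE ac aq /=; exact: uq.
by case: q {pq uq sq aq} lq bc => //= ->; rewrite eqxx.
Qed.

Lemma closer_neighbor_uniq {x z y y'} : E x y -> E x y' ->
  (d z y <= d z x)%N -> (d z y' <= d z x)%N -> y = y'.
Proof.
move=> xy xy' dy dy'.
have [p [pp lp dp]] := descending_path symE connE y z.
have [q [pq lq dq]] := descending_path symE connE y' z.
have neq w : E x w -> x != w by apply: contraTneq => <-; rewrite irrE.
(* The second piece is the descending path from [y'] walked backwards, without [z], where [p]
   already ends. *)
apply: (@acyclic_neighbor_uniq x y y' (p ++ rev (belast y' q))) => //.
- rewrite cat_path pp lp -lq rev_path.
  by apply: sub_path pq => u v; rewrite symE.
- case: q {pq dq} lq => [|w q] lq /=; first by rewrite cats0 lp -lq.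
  by rewrite rev_cons last_cat last_rcons.
rewrite inE negb_or neq //= mem_cat mem_rev negb_or; apply/andP; split.
  by apply/negP => /dp; rewrite ltnNge dy.
(* The strict bound does not cover the endpoint [y'], which differs from [x] because there are no
   loops. *)
apply/negP => /mem_belast; rewrite inE (negbTE (neq _ xy')) /= => /dq.
by rewrite ltnNge dy'.
Qed.

Lemma finite_neighbors x : finite_set (neighbors E x).
Proof. by apply/finite_setP; exists k. Qed.

Lemma degree_regular x : degree E x = k.
Proof. exact: card_fset_set. Qed.

Lemma in_neighbors x y : (y \in fset_set (neighbors E x)) = E x y.
Proof.
rewrite in_fset_set; last exact: finite_neighbors.
by apply/idP/idP; rewrite inE.
Qed.

(** Finiteness keeps [fset_set] away from its empty default value; balls also serve below as common
    index sets for sphere sums. *)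
Lemma finite_ball x n : finite_set [set z | (d z x <= n)%N].
Proof.
elim: n => [|n IH].
  apply: sub_finite_set (finite_set1 x) => z /=.
  by rewrite leqn0 graph_dist_eq0 // => /eqP.
have fU : finite_set (\bigcup_(y in [set z | (d z x <= n)%N]) neighbors E y)%classic.
  by apply: bigcup_finite => // y _; exact: finite_neighbors.
have : finite_set ([set z | (d z x <= n)%N] `|`
    \bigcup_(y in [set z | (d z x <= n)%N]) neighbors E y)%classic.
  by rewrite finite_setU.
apply: sub_finite_set => z /=; rewrite leq_eqVlt => /orP[/eqP|]; last by left.
rewrite graph_distC // => dz; right.
have [y zy dy] := graph_dist_pred symE connE dz.
by exists y => /=; [rewrite graph_distC // dy | rewrite /neighbors /= symE].
Qed.

Lemma finite_sphere x n : finite_set (sphere E x n).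
Proof. by apply: sub_finite_set (finite_ball x n) => z /= ->. Qed.

(** An infinite tree does not fit in a ball of radius 1. On a geodesic of length at least 2, the
    vertex [y] next to the endpoint [x] has two distinct neighbors, [x] and [w]. *)
Lemma regularity_gt1 : (1 < k)%N.
Proof.
have infV : infinite_set [set: V] by case: treeE => _ [].
have [x _] := infinite_setN0 infV.
have [z dz] : exists z, (1 < d z x)%N.
  apply/not_existsP => small; apply: infV.
  apply: sub_finite_set (finite_ball x 1) => z _ /=.
  by rewrite leqNgt; apply/negP.
case dzx : (d z x) dz => [|[|n]] // _.
have [y xy dy] := graph_dist_pred symE connE dzx.
have [w yw dw] := graph_dist_pred symE connE dy.
rewrite -(degree_regular y) /degree.
have sub : ([fset x; w] `<=` fset_set (neighbors E y))%fset.
  by apply/fsubsetP => v; rewrite !inE in_neighbors => /orP[]/eqP-> //; rewrite symE.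
apply: leq_trans (fsubset_leq_card sub); rewrite cardfs2.
by case: eqP dw => //= <-; rewrite dzx => /eqP; lia.
Qed.

(** * Sums over spheres and their cardinalities *)

Section SphereSums.
Context {K : numFieldType}.

Lemma count_neighbors_on_sphere (x z : V) r :
  \sum_(y <- fset_set (neighbors E x)) (d z y == r)%:R =
  (d z x == r.+1)%:R
    + (if d z x == 0%N then k else k.-1)%:R * (r == (d z x).+1)%:R :> K.
Proof.
have natsum (s : seq V) c : \sum_(y <- s) c = (size s)%:R * c :> K.
  by rewrite big_const_seq count_predT iter_addr_0 mulr_natl.
case dzx: (d z x) => [|n] /=.
  have zx : z = x by apply/eqP; rewrite -(graph_dist_eq0 connE) dzx.
  rewrite add0r -[in RHS](degree_regular x) -natsum.
  apply: eq_big_seq => y; rewrite in_neighbors zx => xy.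
  suff -> : d x y = 1%N by rewrite eq_sym.
  apply/eqP; rewrite eqn_leq lt0n graph_dist_eq0 //; apply/andP; split.
    have := graph_dist_edge symE connE y x x; rewrite symE xy => /(_ isT).
    have /eqP -> // : d x x == 0%N by rewrite graph_dist_eq0.
  by apply: contraTneq xy => <-; rewrite irrE.
have [y0 xy0 dy0] := graph_dist_pred symE connE dzx.
(* The neighbor [y0] towards [z] yields the first term; by uniqueness all the others are farther
   from [z] and yield the second. *)
rewrite (big_fsetD1 y0) ?in_neighbors //= dy0 eqSS; congr (_ + _).
have -> : k.-1 = size (fset_set (neighbors E x) `\ y0)%fset.
  by rewrite -(degree_regular x) /degree (cardfsD1 y0) in_neighbors xy0.
rewrite -natsum; apply: eq_big_seq => y; rewrite !inE in_neighbors => /andP[yy0 xy].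
suff -> : d z y = n.+2 by rewrite eq_sym.
apply/eqP; rewrite eqn_leq -dzx graph_dist_edge // ?(symE y) //= ltnNge.
by apply: contra yy0 => dy; rewrite (closer_neighbor_uniq xy xy0 dy) // dy0 dzx.
Qed.

Implicit Type phi : V -> K.

(** Indicator weights over one fixed sequence let spheres with different centers share an index set,
    so that sums can be exchanged. *)
Lemma sphere_sum_seq {phi x n} {B : seq V} : uniq B ->
  (forall z, d z x = n -> z \in B) ->
  \sum_(z \in sphere E x n) phi z = \sum_(z <- B) (d z x == n)%:R * phi z.
Proof.
move=> uB sB.
have -> : sphere E x n = [set` (fun z => d z x == n)]%classic.
  by apply/seteqP; split => z /eqP.
rewrite -(bigfs _ uB) => [|z /eqP/sB -> //].
by rewrite big_mkcond; apply: eq_bigr => z _; case: eqP; rewrite ?mul1r ?mul0r.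
Qed.

Lemma neighbors_sphere_sum_ball phi x r :
  \sum_(y \in neighbors E x) \sum_(z \in sphere E y r) phi z =
  \sum_(z \in sphere E x r.+1) phi z +
  \sum_(z <- fset_set [set z | (d z x <= r.+1)%N])
    (if d z x == 0%N then k else k.-1)%:R * (r == (d z x).+1)%:R * phi z.
Proof.
(* This ball contains the sphere of radius [r.+1] about [x] and all spheres of radius [r] about its
   neighbors. *)
set B := fset_set _.
have inB z : (d z x <= r.+1)%N -> z \in B.
  by move=> dz; rewrite in_fset_set ?inE //; exact: finite_ball.
rewrite fsbig_finite /=; last exact: finite_neighbors.
rewrite (sphere_sum_seq (fset_uniq B)) => [|z dz]; last by rewrite inB ?dz.
rewrite -big_split /=.
under [RHS]eq_bigr do rewrite -mulrDl -count_neighbors_on_sphere mulr_suml.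
rewrite exchange_big /=; apply: eq_big_seq => y; rewrite in_neighbors => xy.
apply: sphere_sum_seq (fset_uniq B) _ => z dz; apply: inB.
by rewrite -dz graph_dist_edge.
Qed.

Lemma neighbors_sphere_sum0 phi x :
  \sum_(y \in neighbors E x) \sum_(z \in sphere E y 0) phi z =
  \sum_(z \in sphere E x 1) phi z.
Proof.
rewrite neighbors_sphere_sum_ball [X in _ + X]big1 ?addr0 // => z _.
by rewrite mulr0 mul0r.
Qed.

(** For [r = 0] the coefficient is [k] because the center [x] lies at distance 1 from all of its [k]
    neighbors. *)
Lemma neighbors_sphere_sumS phi x r :
  \sum_(y \in neighbors E x) \sum_(z \in sphere E y r.+1) phi z =
  \sum_(z \in sphere E x r.+2) phi z +
  (if r == 0%N then k else k.-1)%:R * \sum_(z \in sphere E x r) phi z.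
Proof.
rewrite neighbors_sphere_sum_ball; congr (_ + _).
set B := fset_set _.
rewrite (sphere_sum_seq (fset_uniq B)) => [|z dz]; last first.
  rewrite in_fset_set ?inE /= ?dz //; [lia | exact: finite_ball].
rewrite mulr_sumr; apply: eq_bigr => z _.
rewrite eqSS mulrA [r == d z x]eq_sym; case: (d z x =P r) => [->|_] //.
by rewrite !mulr0.
Qed.

Lemma sphere_card_sum x n : (sphere_card E x n)%:R = \sum_(z \in sphere E x n) (1 : K).
Proof.
rewrite fsbig_finite /=; last exact: finite_sphere.
by rewrite big_const_seq count_predT iter_addr_0.
Qed.

Lemma sphere0 x : sphere E x 0 = [set x]%classic.
Proof.
apply/seteqP; split => z /= => [/eqP|->]; first by rewrite graph_dist_eq0 // => /eqP.
by apply/eqP; rewrite graph_dist_eq0.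
Qed.

Lemma sphere_card0 x : (sphere_card E x 0)%:R = 1 :> K.
Proof. by rewrite sphere_card_sum sphere0 fsbig_set1. Qed.

Lemma regularity_predr : k.-1%:R = k%:R - 1 :> K.
Proof. by rewrite -subn1 natrB // ltnW ?regularity_gt1. Qed.

(** For the constant function 1 the sphere sums become a two-step recursion for the cardinalities,
    solved by strong induction. *)
Lemma sphere_cardS x n :
  (sphere_card E x n.+1)%:R = k%:R * (k%:R - 1) ^+ n :> K.
Proof.
have sumN u m c : (forall y, (sphere_card E y m)%:R = c) ->
    \sum_(y \in neighbors E u) \sum_(z \in sphere E y m) (1 : K) = k%:R * c.
  move=> cE; under eq_fsbigr do rewrite -sphere_card_sum cE.
  rewrite fsbig_finite /=; last exact: finite_neighbors.
  rewrite big_const_seq count_predT iter_addr_0 mulr_natl; congr (_ *+ _).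
  exact: degree_regular.
move: x; elim/ltn_ind: n => -[|n] IH x.
  by rewrite sphere_card_sum -neighbors_sphere_sum0 (sumN _ _ _ sphere_card0) expr0.
have := neighbors_sphere_sumS (fun=> 1) x n.
rewrite (sumN _ _ _ (IH n (ltnSn n))) -!sphere_card_sum => /esym/(canRL (addrK _))->.
(* The radius 2 is separate: the recursion then has coefficient [k] and reaches down to radius 0,
   where the closed formula fails. *)
case: n IH => [|n] IH /=; first by rewrite sphere_card0; ring.
by rewrite IH // regularity_predr !exprS; ring.
Qed.

(** Since [K] has characteristic 0 and [k] exceeds 1, both [k] and [k - 1] are invertible. *)
Lemma sphere_card_neq0 x n : (sphere_card E x n)%:R != 0 :> K.
Proof.
have k1 : (1 < k%:R :> K) by rewrite ltr1n regularity_gt1.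
case: n => [|n]; first by rewrite sphere_card0 oner_eq0.
rewrite sphere_cardS mulf_neq0 ?expf_neq0 // ?subr_eq0 ?gt_eqF //.
exact: lt_trans ltr01 k1.
Qed.

Lemma sphere_card_center x y n :
  (sphere_card E x n)%:R = (sphere_card E y n)%:R :> K.
Proof. by case: n => [|n]; rewrite ?sphere_card0 ?sphere_cardS. Qed.

Lemma neighbors_spherical_mean phi x (n : nat) :
  \sum_(y \in neighbors E x) spherical_mean E phi y n =
  (sphere_card E x n)%:R^-1 *
    \sum_(y \in neighbors E x) \sum_(z \in sphere E y n) phi z.
Proof.
rewrite mulr_fsumr; apply: eq_fsbigr => y _.
by rewrite /spherical_mean /= (sphere_card_center x y).
Qed.

End SphereSums.
End Tree.

(** * The path Laplacian and the final identity *)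

Lemma laplacian_path_edge (K : fieldType) (v : int -> K) r :
  laplacian path_edge v r = 2%:R * v r - (v (r + 1) + v (r - 1)).
Proof.
have nE : neighbors path_edge r = ([set r + 1] `|` [set r - 1])%classic.
  apply/seteqP; split => s /=; rewrite /neighbors /path_edge /=.
    by move=> /orP[]/eqP ->; [left | right => /=; rewrite addrK].
  by case=> /= ->; rewrite ?eqxx // subrK eqxx orbT.
rewrite /laplacian /degree nE fset_setU ?fset_set1 // cardfs2.
rewrite fsbigU0 ?fsbig_set1 //=; last by move=> s [/= -> /eqP]; lia.
by have -> : r + 1 != r - 1 by lia.
Qed.

Theorem theorem4p2 (R : realType) (k : nat) (V : choiceType) (E : rel V)
    (treeE : infinite_regular_tree E k) (phi : V -> R[i]) (x : V) (r : int)
    (r_ge0 : 0 <= r) :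
  laplacian E (fun y => spherical_mean E phi y r) x =
  laplacian path_edge (spherical_mean E phi x) r
  + (2%:R - k%:R) * forward_diff (spherical_mean E phi x) r.
Proof.
rewrite laplacian_path_edge /forward_diff {1}/laplacian (degree_regular treeE).
case: r r_ge0 => // n _; rewrite (neighbors_spherical_mean treeE).
have -> : Posz n + 1 = n.+1 by rewrite intS addrC.
have cardN0 m := sphere_card_neq0 treeE (K := R[i]) x m.
(* At radius 0 there is no inner sphere in the tree, while on the path the even extension replaces
   the value at -1 by the one at 1. *)
case: n => [|n].
  rewrite (neighbors_sphere_sum0 treeE) sub0r.
  have -> : spherical_mean E phi x (-1) = spherical_mean E phi x 1 by [].
  rewrite /spherical_mean /= (sphere_card0 treeE) (sphere_cardS treeE) expr0 mulr1.
  have k0 : k%:R != 0 :> R[i].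
    by have := cardN0 1%N; rewrite (sphere_cardS treeE) expr0 mulr1.
  by field.
have -> : Posz n.+1 - 1 = n by rewrite intS addrC addKr.
rewrite (neighbors_sphere_sumS treeE) /spherical_mean /=.
(* These two ratios turn the outer and inner sphere sums, divided by the cardinality at radius
   [n.+1], into [k - 1] times the mean at [n.+2] and once the mean at [n]. *)
have c2 : (sphere_card E x n.+2)%:R = (k%:R - 1) * (sphere_card E x n.+1)%:R :> R[i].
  by rewrite !(sphere_cardS treeE) exprS mulrCA.
have c1 : (sphere_card E x n.+1)%:R =
    (if n == 0%N then k else k.-1)%:R * (sphere_card E x n)%:R :> R[i].
  case: n {c2} => [|n] /=; first by rewrite (sphere_cardS treeE) (sphere_card0 treeE) expr0.
  by rewrite !(sphere_cardS treeE) (regularity_predr treeE) exprS mulrCA.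
have := cardN0 n.+2; have := cardN0 n.+1; have := cardN0 n.
rewrite c2 c1 !mulf_eq0 !negb_or => c0 /andP[a0 _] /and3P[q0 _ _].
by field; rewrite q0 a0 c0.
Qed.
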